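(* Let $\mathbf{K}$ be a field of characteristic zero and let $A,B\in\mathbf{K}$. Let $\wp(z)=\frac{1}{z^2}+\sum_{i\ge 1} c_i z^{2i}\in\mathbf{K}((z))$ be the Laurent series satisfying the differential equation $\wp'(z)^2=4\bigl(\wp(z)^3+A\wp(z)+B\bigr)$. Then, given $A$, $B$ and $n$, the first $n$ coefficients of the Laurent expansion of $\wp$ at the origin (i.e. $c_1,\dots,c_n$) can be computed using $O(\mathsf{M}(n))$ arithmetic operations in $\mathbf{K}$.
   Context: $\mathsf{M}:\mathbb{N}\to\mathbb{N}$ denotes a multiplication-time function: polynomials of degree less than $n$ over $\mathbf{K}$ can be multiplied using $\mathsf{M}(n)$ operations in $\mathbf{K}$, and $\mathsf{M}$ is assumed super-linear in the sense that $\mathsf{M}(n)/n\le \mathsf{M}(n')/n'$ whenever $n\le n'$ (e.g. one may take $\mathsf{M}(n)\in O(n\log n\log\log n)$). Complexity is measured as the number of arithmetic operations in $\mathbf{K}$. The series $\wp$ is uniquely determined by the differential equation and the stated form of its expansion; in particular $c_1=-A/5$, $c_2=-B/7$. *)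

(* Defs.v *)
From HB Require Import structures.
From mathcomp Require Import all_boot all_order all_algebra.
From mathcomp Require Import boolp classical_sets fsbigop.

Set Implicit Arguments.
Unset Strict Implicit.
Unset Printing Implicit Defensive.

Import Order.TTheory GRing.Theory Num.Theory.
Local Open Scope ring_scope.

(* Cost model: algebraic computation trees.  The memory is a sequence of field
   elements, initially the input; [Const] and [Arith] append one cell to it.
   Only the field operations +, -, *, / are charged; constants of K, tests for
   zero and reading or copying cells are free.  An algorithm whose control
   depends on an integer parameter n unrolls to one tree for each n. *)
Variant arith_op := Add | Sub | Mul | Div.

Inductive ctree (K : Type) :=
| Output of seq nat
| Const of K & ctree K
| Arith of arith_op & nat & nat & ctree K
| IfZero of nat & ctree K & ctree K.

Arguments Output {K}.

Section ComputationTrees.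
Variable K : fieldType.

(* Partial on purpose: with the convention 0^-1 = 0 a division by zero would
   otherwise be a legal operation. *)
Definition arith (o : arith_op) (x y : K) : option K :=
  match o with
  | Add => Some (x + y)
  | Sub => Some (x - y)
  | Mul => Some (x * y)
  | Div => if y == 0 then None else Some (x / y)
  end.

Fixpoint read (s : seq K) (idx : seq nat) : option (seq K) :=
  if idx is i :: idx' then
    if (onth s i, read s idx') is (Some x, Some xs) then Some (x :: xs)
    else None
  else Some [::].

(* The number of charged operations along the path followed on the memory [s],
   with the output; [None] on a division by zero or an invalid address. *)
Fixpoint run (t : ctree K) (s : seq K) : option (nat * seq K) :=
  match t with
  | Output idx => omap (pair 0%N) (read s idx)
  | Const a t' => run t' (rcons s a)
  | Arith o i j t' =>
      if (onth s i, onth s j) is (Some x, Some y) then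
        if arith o x y is Some z then
          omap (fun r => (r.1.+1, r.2)) (run t' (rcons s z))
        else None
      else None
  | IfZero i t0 t1 =>
      if onth s i is Some x then run (if x == 0 then t0 else t1) s else None
  end.

Definition computes_within (t : ctree K) (b : nat) (inp out : seq K) : Prop :=
  exists2 k : nat, run t inp = Some (k, out) & (k <= b)%N.

Definition coefs (n : nat) (p : {poly K}) : seq K := mkseq (fun i => p`_i) n.

(* The product of two polynomials of degree < n has degree < 2n - 1. *)
Definition multiplication_time (M : nat -> nat) : Prop :=
  forall n : nat, exists t : ctree K, forall p q : {poly K},
    (size p <= n)%N -> (size q <= n)%N ->
    computes_within t (M n) (coefs n p ++ coefs n q) (coefs (n.*2).-1 (p * q)).

End ComputationTrees.

Definition superlinear (M : nat -> nat) : Prop :=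
  forall n n' : nat, (0 < n)%N -> (n <= n')%N ->
    (M n)%:R / n%:R <= (M n')%:R / n'%:R :> rat.

Section Laurent.
Variable K : fieldType.

(* An element of K((z)) is given by its coefficients: a function on int that
   vanishes below some index.  For two such functions the sum in [lmul] has
   finite support. *)
Definition lmul (f g : int -> K) : int -> K :=
  fun k => \sum_(i \in [set: int]) (f i * g (k - i)).

Definition lderiv (f : int -> K) : int -> K :=
  fun k => (k + 1)%:~R * f (k + 1).

Definition lconst (a : K) : int -> K := fun k => if k == 0 then a else 0.

(* z^-2 + \sum_(i >= 1) c i * z^(2i); the value c 0 is not used. *)
Definition wp_series (c : nat -> K) : int -> K := fun k =>
  match k with
  | Posz m => if (0 < m)%N && ~~ odd m then c m./2 else 0
  | Negz m => if m == 1%N then 1 else 0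
  end.

(* wp'^2 = 4 (wp^3 + A wp + B) in K((z)), coefficient by coefficient. *)
Definition is_wp (A B : K) (c : nat -> K) : Prop :=
  let wp := wp_series c in
  forall k : int,
    lmul (lderiv wp) (lderiv wp) k =
    4%:R * (lmul wp (lmul wp wp) k + A * wp k + lconst B k).

End Laurent.

(* Main.v *)
(** The series [f = 1 + \sum_(i >= 1) c_i x^(i+1)] (that is, [z^2 wp(z)] with
    [x = z^2]) is a root of [E(f) = h^2 - f^3 - A x^2 f - B x^3], where
    [theta = x d/dx] and [h = theta f - f].  Comparing coefficients of [x^k]
    shows that [f] modulo [x^n] is determined by [E(f) = 0] modulo [x^n] and
    [f(0) = 1].  As the differential equation is autonomous, the derivative of
    wp solves its linearization; hence a Newton step is [f - h J] where
    [2 theta J + J = E(f) / h^2], and needs only products and one quadrature.  The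
    inverse of [h^2] is updated by a Newton step of its own, so that both
    precisions double.  Superlinearity makes the cost of the steps up to
    [2^j <= n] geometric; the last two steps go beyond [n] and use
    multiplications assembled from blocks of size [2^j]. *)

Require Import Defs.
From mathcomp Require Import all_boot all_order all_algebra.
From mathcomp Require Import classical_sets fsbigop.
From mathcomp Require Import zify ring.

Set Implicit Arguments.
Unset Strict Implicit.
Unset Printing Implicit Defensive.

Import Order.TTheory GRing.Theory Num.Theory.

(** * Sequential composition of computation trees *)

Section Grafting.
Variable K : fieldType.

(* The run of [t] on a virtual memory whose [i]-th cell has address [rho_i] in a
   memory of actual size [m], continued by [k] with the final memory size and the
   addresses of the output.  Branches may leave memories of different sizes. *)
Fixpoint graft (rho : seq nat) (m : nat) (t : ctree K)
    (k : nat -> seq nat -> ctree K) : ctree K :=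
  match t with
  | Output idx => k m (map (nth 0 rho) idx)
  | Const a t' => Const a (graft (rcons rho m) m.+1 t' k)
  | Arith o i j t' =>
      Arith o (nth 0 rho i) (nth 0 rho j) (graft (rcons rho m) m.+1 t' k)
  | IfZero i t0 t1 => IfZero (nth 0 rho i) (graft rho m t0 k) (graft rho m t1 k)
  end.

Lemma onth_cat (s e : seq K) i x : onth s i = Some x -> onth (s ++ e) i = Some x.
Proof. by elim: s i => [|y s IH] [|i] //=; apply: IH. Qed.

Lemma onth_rcons (s : seq K) a : onth (rcons s a) (size s) = Some a.
Proof. by elim: s. Qed.

Lemma read_cat (s e : seq K) idx xs :
  read s idx = Some xs -> read (s ++ e) idx = Some xs.
Proof.
elim: idx xs => [|i idx IH] xs //=.
case E: (onth s i) => [x|] //; case F: (read s idx) => [ys|] //= [<-].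
by rewrite (onth_cat e E) (IH _ F).
Qed.

Lemma read_rcons (s : seq K) idx xs i x :
  read s idx = Some xs -> onth s i = Some x ->
  read s (rcons idx i) = Some (rcons xs x).
Proof.
elim: idx xs => [|j idx IH] xs /=; first by move=> [<-] ->.
case E: (onth s j) => [y|] //; case F: (read s idx) => [ys|] //= [<-] Hi.
by rewrite (IH _ F Hi).
Qed.

Lemma onth_read (s : seq K) rho xs i x :
  read s rho = Some xs -> onth xs i = Some x -> onth s (nth 0 rho i) = Some x.
Proof.
elim: rho xs i => [|j rho IH] xs i /=; first by move=> [<-]; case: i.
case E: (onth s j) => [y|] //; case F: (read s rho) => [ys|] //= [<-].
case: i => [|i] /=; first by move=> [<-].
exact: IH.
Qed.

Lemma read_read (s : seq K) rho xs idx ys :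
  read s rho = Some xs -> read xs idx = Some ys ->
  read s (map (nth 0 rho) idx) = Some ys.
Proof.
move=> Hr; elim: idx ys => [|i idx IH] ys //=.
case E: (onth xs i) => [x|] //; case F: (read xs idx) => [zs|] //= [<-].
by rewrite (onth_read Hr E) (IH _ F).
Qed.

(** Memory only grows, so addresses valid before the run stay valid: [e] holds the cells appended
    along the path taken, and the continuation starts from [s ++ e] with the cost of [t] added to
    its own. *)
Lemma run_graft t k rho s xs c out :
  read s rho = Some xs -> run t xs = Some (c, out) ->
  exists e idx, read (s ++ e) idx = Some out /\
    run (graft rho (size s) t k) s =
    omap (fun r => (c + r.1, r.2)) (run (k (size (s ++ e)) idx) (s ++ e)).
Proof.
have omap_id (o : option (nat * seq K)) :
    omap (fun r => (0 + r.1, r.2)) o = o by case: o => [[]|].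
have read_step (s' : seq K) rho' xs' z : read s' rho' = Some xs' ->
    read (rcons s' z) (rcons rho' (size s')) = Some (rcons xs' z).
  move=> H; apply: read_rcons; last exact: onth_rcons.
  by rewrite -cats1; apply: read_cat.
elim: t rho s xs c out => [idx|a t IH|o i j t IH|i t0 IH0 t1 IH1] rho s xs c out Hr /=.
- case E: (read xs idx) => [ys|] //= [<- <-].
  exists [::], (map (nth 0 rho) idx); rewrite cats0 omap_id.
  by split=> //; apply: read_read E.
- move=> Ht; have [e [idx [H1 H2]]] := IH _ _ _ _ _ (read_step _ _ _ a Hr) Ht.
  by exists (a :: e), idx; move: H1 H2; rewrite size_rcons cat_rcons.
- case Ei: (onth xs i) => [x|] //; case Ej: (onth xs j) => [y|] //.
  case Ez: (arith o x y) => [z|] //.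
  case Ht: (run t _) => [[c' out']|] //= [<- <-].
  have [e [idx [H1 H2]]] := IH _ _ _ _ _ (read_step _ _ _ z Hr) Ht.
  exists (z :: e), idx; move: H1 H2; rewrite size_rcons cat_rcons => H1 H2.
  split=> //; rewrite (onth_read Hr Ei) (onth_read Hr Ej) Ez H2.
  by case: (run _ _) => [[]|].
- case Ei: (onth xs i) => [x|] //= Ht; rewrite (onth_read Hr Ei).
  by case: (x == 0)%R Ht => Ht; [apply: IH0 Ht | apply: IH1 Ht].
Qed.

Lemma read_iota (s s' : seq K) : read (s ++ s') (iota 0 (size s)) = Some s.
Proof.
suff gen r : read (r ++ s ++ s') (iota (size r) (size s)) = Some s by exact: (gen [::]).
elim: s r => [|x s IH] r //=.
have -> : onth (r ++ x :: s ++ s') (size r) = Some x by elim: r.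
by have := IH (rcons r x); rewrite size_rcons cat_rcons => ->.
Qed.

Lemma read_catidx (s : seq K) i1 i2 x1 x2 : read s i1 = Some x1 ->
  read s i2 = Some x2 -> read s (i1 ++ i2) = Some (x1 ++ x2).
Proof.
move=> + H2; elim: i1 x1 => [|i i1 IH] x1 /=; first by move=> [<-].
by case: (onth s i) => [y|] //; case: (read s i1) IH => [ys|] // IH [<-];
  rewrite (IH _ erefl).
Qed.

End Grafting.

(** * Rules for combining uniform computations and adding their costs *)

Section Calculus.
Variables (K : fieldType) (T : Type).
Implicit Types F G H : seq (T -> K).

Definition evs F (x : T) : seq K := [seq g x | g <- F].

(* One tree serves all the parameters [x]. *)
Definition computable b F G : Prop :=
  exists t, forall x, computes_within t b (evs F x) (evs G x).

Lemma comp_ext b F G G' :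
  (forall x, evs G x = evs G' x) -> computable b F G -> computable b F G'.
Proof. by move=> E [t Ht]; exists t => x; rewrite -E. Qed.

Lemma comp_le b b' F G : b <= b' -> computable b F G -> computable b' F G.
Proof.
move=> le [t Ht]; exists t => x; have [k Hk lek] := Ht x.
by exists k => //; apply: leq_trans le.
Qed.

(** The second tree is grafted onto the outputs of the first; the addresses [rho] select the inputs
    that remain available beside [G]. Keeping all of them gives [comp_let], keeping none gives
    [comp_trans]. *)
Lemma comp_bind rho b1 b2 F F' G H :
  (forall x, read (evs F x) rho = Some (evs F' x)) ->
  computable b1 F G -> computable b2 (F' ++ G) H -> computable (b1 + b2) F H.
Proof.
move=> rF [t1 H1] [t2 H2]; pose n := size F.
pose k2 := fun (_ : nat) idx => @Output K idx.
pose k1 := fun m idx => graft (rho ++ idx) m t2 k2.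
exists (graft (iota 0 n) n t1 k1) => x.
have [c1 R1 le1] := H1 x; have [c2 R2 le2] := H2 x.
have sz : size (evs F x) = n by rewrite size_map.
have iF : read (evs F x) (iota 0 n) = Some (evs F x).
  by rewrite -{1}[evs F x]cats0 -sz read_iota.
have [e [idx [Hr Hrun]]] := run_graft k1 iF R1.
have rFG : read (evs F x ++ e) (rho ++ idx) = Some (evs (F' ++ G) x).
  by rewrite /evs map_cat; apply: read_catidx Hr; apply: read_cat.
have [e' [idx' [Hr' Hrun']]] := run_graft k2 rFG R2.
exists (c1 + c2); last exact: leq_add.
by move: Hrun; rewrite sz => ->; rewrite Hrun' /= Hr' /= addn0.
Qed.

Lemma comp_let b1 b2 F G H :
  computable b1 F G -> computable b2 (F ++ G) H -> computable (b1 + b2) F H.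
Proof.
apply: (@comp_bind (iota 0 (size F))) => x.
by rewrite -{1}[evs F x]cats0 -(size_map (fun g => g x)) read_iota.
Qed.

Lemma comp_trans b1 b2 F G H :
  computable b1 F G -> computable b2 G H -> computable (b1 + b2) F H.
Proof. exact: (@comp_bind [::] _ _ _ [::]). Qed.

Lemma comp_read idx F G :
  (forall x, read (evs F x) idx = Some (evs G x)) -> computable 0 F G.
Proof. by move=> H; exists (Output idx) => x; exists 0 => //=; rewrite H. Qed.

Lemma comp_catl F1 F2 : computable 0 (F1 ++ F2) F1.
Proof.
apply: (@comp_read (iota 0 (size F1))) => x.
by rewrite /evs map_cat -(size_map (fun g => g x)) read_iota.
Qed.

Lemma comp_id F : computable 0 F F.
Proof. by rewrite -{1}[F]cats0; apply: comp_catl. Qed.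

Lemma comp_nil F : computable 0 F [::].
Proof. exact: (@comp_read [::]). Qed.

Lemma comp_nth F i : i < size F -> computable 0 F [:: nth (fun=> 0%R) F i].
Proof.
move=> lti; apply: (@comp_read [:: i]) => x /=.
suff -> : onth (evs F x) i = Some (nth (fun=> 0%R) F i x) by [].
by elim: F i lti => [|g F IH] [|i] //=; apply: IH.
Qed.

Lemma comp_const F a : computable 0 F [:: fun=> a].
Proof.
exists (Const a (Output [:: size F])) => x; exists 0 => //=.
by rewrite -(size_map (fun g => g x)) onth_rcons.
Qed.

Lemma comp_catr F1 F2 : computable 0 (F1 ++ F2) F2.
Proof.
apply: (@comp_read (iota (size F1) (size F2))) => x.
rewrite /evs map_cat -!(size_map (fun g => g x)).
elim: [seq g x | g <- F2] (_ F1 : seq K) => [|y s IH] r //=.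
have -> : onth (r ++ y :: s) (size r) = Some y by elim: r.
by have := IH (rcons r y); rewrite size_rcons cat_rcons => ->.
Qed.

Lemma comp_cat b1 b2 F G1 G2 :
  computable b1 F G1 -> computable b2 F G2 -> computable (b1 + b2) F (G1 ++ G2).
Proof.
move=> H1 H2; apply: (comp_let H1); rewrite -[b2]addn0.
have H2' := comp_trans (comp_catl F G1) H2.
apply: (comp_let H2'); rewrite -catA; exact: comp_catr.
Qed.

Lemma comp_mkseq b F m (g : nat -> T -> K) :
  (forall j, j < m -> computable b F [:: g j]) -> computable (m * b) F (mkseq g m).
Proof.
elim: m => [|m IH] H; first exact: comp_nil.
rewrite mkseqS -cats1 mulSnr; apply: comp_cat (H m _) => //.
by apply: IH => j ltj; apply: H; apply: ltnW.
Qed.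

Lemma comp_arith o b1 b2 F (u v w : T -> K) :
  (forall x, arith o (u x) (v x) = Some (w x)) ->
  computable b1 F [:: u] -> computable b2 F [:: v] -> computable (b1 + b2).+1 F [:: w].
Proof.
move=> E Hu Hv; rewrite -addn1; apply: comp_trans (comp_cat Hu Hv) _.
by exists (Arith o 0 1 (Output [:: 2])) => x; exists 1; rewrite //= E.
Qed.
End Calculus.

(** * Costs of coefficientwise operations and of truncated products *)

Section PolynomialArithmetic.
Local Open Scope ring_scope.
Variables (K : fieldType) (T : Type).
Implicit Types (F : seq (T -> K)) (p q r : T -> {poly K}).

Definition pc n p : seq (T -> K) := mkseq (fun i x => (p x)`_i) n.

Lemma evs_pc n p x : evs (pc n p) x = coefs n (p x).
Proof. by rewrite /evs /pc /coefs -map_comp. Qed.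

Lemma comp_pc_ext b F n p q : (forall x i, (i < n)%N -> (p x)`_i = (q x)`_i) ->
  computable b F (pc n p) -> computable b F (pc n q).
Proof.
move=> E; apply: comp_ext => x; rewrite !evs_pc /coefs.
apply/eq_in_map => i; rewrite mem_iota add0n => /andP[_ lti]; exact: E.
Qed.

Lemma comp_coef b F n p i : (i < n)%N -> computable b F (pc n p) ->
  computable b F [:: fun x => (p x)`_i].
Proof.
move=> lti H; rewrite -[b]addn0; apply: comp_trans H _.
have := @comp_nth _ _ (pc n p) i; rewrite size_mkseq nth_mkseq //; exact.
Qed.

Lemma comp_pcwise b c F G n r : computable b F G ->
  (forall i, (i < n)%N -> computable c G [:: fun x => (r x)`_i]) ->
  computable (b + n * c) F (pc n r).
Proof. by move=> HG H; apply: comp_trans HG _; apply: comp_mkseq. Qed.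

Lemma comp_scalar_ext b F (g h : T -> K) : (forall x, g x = h x) ->
  computable b F [:: g] -> computable b F [:: h].
Proof. by move=> E; apply: comp_ext => x /=; rewrite E. Qed.

Lemma comp_catll b F1 F2 G : computable b F1 G -> computable b (F1 ++ F2) G.
Proof. exact: comp_trans (comp_catl F1 F2). Qed.

Lemma comp_catrr b F1 F2 G : computable b F2 G -> computable b (F1 ++ F2) G.
Proof. exact: comp_trans (comp_catr F1 F2). Qed.

Lemma comp_arith_poly o b1 b2 F n p q r :
  (forall x i, (i < n)%N -> arith o (p x)`_i (q x)`_i = Some (r x)`_i) ->
  computable b1 F (pc n p) -> computable b2 F (pc n q) ->
  computable (b1 + b2 + n) F (pc n r).
Proof.
move=> E Hp Hq; rewrite -{1}[n]muln1; apply: comp_pcwise (comp_cat Hp Hq) _.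
move=> i lti; apply: (@comp_arith _ _ o 0 0 _ (fun x => (p x)`_i) (fun x => (q x)`_i)).
- by move=> x; apply: E.
- exact/comp_catll/comp_coef/comp_id.
- exact/comp_catrr/comp_coef/comp_id.
Qed.

Lemma comp_add b1 b2 F n p q : computable b1 F (pc n p) -> computable b2 F (pc n q) ->
  computable (b1 + b2 + n) F (pc n (fun x => p x + q x)).
Proof. by apply: (@comp_arith_poly Add) => x i _ /=; rewrite coefD. Qed.

Lemma comp_sub b1 b2 F n p q : computable b1 F (pc n p) -> computable b2 F (pc n q) ->
  computable (b1 + b2 + n) F (pc n (fun x => p x - q x)).
Proof. by apply: (@comp_arith_poly Defs.Sub) => x i _ /=; rewrite coefB. Qed.

Lemma comp_scale b1 b2 F n (a : T -> K) p :
  computable b1 F [:: a] -> computable b2 F (pc n p) ->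
  computable (b1 + b2 + n) F (pc n (fun x => a x *: p x)).
Proof.
move=> Ha Hp; rewrite -{1}[n]muln1; apply: comp_pcwise (comp_cat Ha Hp) _ => i lti.
apply: (@comp_arith _ _ Mul 0 0 _ a (fun x => (p x)`_i)).
- by move=> x /=; rewrite coefZ.
- exact/(@comp_catll _ [:: a])/comp_id.
- exact/(@comp_catrr _ [:: a])/comp_coef/comp_id.
Qed.

Lemma comp_diag b F n (a : nat -> K) p r :
  (forall x i, (i < n)%N -> (r x)`_i = a i * (p x)`_i) ->
  computable b F (pc n p) -> computable (b + n) F (pc n r).
Proof.
move=> E Hp; rewrite -{1}[n]muln1; apply: comp_pcwise Hp _ => i lti.
apply: (@comp_arith _ _ Mul 0 0 _ (fun=> a i) (fun x => (p x)`_i)).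
- by move=> x /=; rewrite E.
- exact: comp_const.
- exact/comp_coef/comp_id.
Qed.

(** Copying cells and writing constants are free, so any rearrangement of coefficients is: shifts,
    truncation and padding by zeros are instances. *)
Lemma comp_copy b F n m p r :
  (forall i, (i < m)%N -> (exists2 j, (j < n)%N & forall x, (r x)`_i = (p x)`_j) \/
                          (exists a, forall x, (r x)`_i = a)) ->
  computable b F (pc n p) -> computable b F (pc m r).
Proof.
move=> E Hp; rewrite -[b]addn0 -(muln0 m); apply: comp_pcwise Hp _ => i /E.
case=> [[j ltj Er]|[a Ea]].
- apply: (@comp_scalar_ext _ _ (fun x => (p x)`_j)) => [x|]; first by rewrite Er.
  exact/comp_coef/comp_id.
- apply: (@comp_scalar_ext _ _ (fun=> a)) => [x|]; first by rewrite Ea.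
  exact: comp_const.
Qed.

Lemma comp_shift b F n k p : computable b F (pc n p) ->
  computable b F (pc n (fun x => 'X^k * p x)).
Proof.
apply: comp_copy => i lti; case: (ltnP i k) => le.
  by right; exists 0 => x; rewrite coefXnM le.
by left; exists (i - k)%N => [|x]; [lia | rewrite coefXnM ltnNge le].
Qed.

Lemma comp_resize b F n m p : (forall x, size (p x) <= n)%N ->
  computable b F (pc n p) -> computable b F (pc m p).
Proof.
move=> szp; apply: comp_copy => i _; case: (ltnP i n) => le; first by left; exists i.
by right; exists 0 => x; apply/nth_default/(leq_trans (szp x)).
Qed.

Lemma comp_prefix b F n m p : (m <= n)%N ->
  computable b F (pc n p) -> computable b F (pc m p).
Proof. by move=> le; apply: comp_copy => i lti; left; exists i => //; lia. Qed.

(** Multiplication at one fixed size, with a cost [b] that need not be a value of [M], so that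
    multiplications for larger sizes can be assembled from it. *)
Definition multiplier n b : Prop := forall p q,
  (forall x, size (p x) <= n)%N -> (forall x, size (q x) <= n)%N ->
  computable b (pc n p ++ pc n q) (pc (n.*2).-1 (fun x => p x * q x)).

Lemma multiplier_time M : multiplication_time K M -> forall n, multiplier n (M n).
Proof.
move=> HM n p q szp szq; have [t Ht] := HM n; exists t => x.
by rewrite /evs map_cat -!/(evs _ _) !evs_pc; apply: Ht.
Qed.

Lemma coef_mul_take n (p q : {poly K}) i : (i < n)%N ->
  (take_poly n p * take_poly n q)`_i = (p * q)`_i.
Proof.
move=> lti; rewrite !coefM; apply: eq_bigr => j _.
have := ltn_ord j; rewrite ltnS => lej; rewrite !coef_take_poly (leq_ltn_trans lej lti).
by rewrite (leq_ltn_trans (leq_subr _ _) lti).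
Qed.

(** Coefficients of a product below [n] depend only on those of the factors, so both factors are
    first cut to size [n]; this gives arithmetic modulo [X^n]. *)
Lemma comp_mul n b b1 b2 F p q : multiplier n b ->
  computable b1 F (pc n p) -> computable b2 F (pc n q) ->
  computable (b1 + b2 + b) F (pc n (fun x => p x * q x)).
Proof.
move=> Hm Hp Hq.
have cut r c : computable c F (pc n r) ->
    computable c F (pc n (fun x => take_poly n (r x))).
  by apply: comp_pc_ext => x i lti; rewrite coef_take_poly lti.
have H := comp_trans (comp_cat (cut _ _ Hp) (cut _ _ Hq))
  (Hm _ _ (fun x => size_take_poly n (p x)) (fun x => size_take_poly n (q x))).
apply: comp_pc_ext (comp_prefix _ H) => [x i lti|]; last by lia.
exact: coef_mul_take.
Qed.

(** Schoolbook splitting at [X^n]: four products of size [n] and three additions of length [4n - 1].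
    Superlinearity yields no upper bound for [M (2n)] in terms of [M n]; this splitting supplies a
    substitute. *)
Lemma multiplier_double n b : multiplier n b -> multiplier n.*2 (4 * b + 12 * n).
Proof.
move=> Hm p q szp szq; set F := _ ++ _.
pose lo r x := take_poly n (r x : {poly K}); pose hi r x := drop_poly n (r x : {poly K}).
have Hlo r : computable 0 F (pc n.*2 r) -> computable 0 F (pc n (lo r)).
  by move/(@comp_prefix _ _ _ n); rewrite -addnn leq_addr => /(_ isT);
    apply: comp_pc_ext => x i lti; rewrite coef_take_poly lti.
have Hhi r : computable 0 F (pc n.*2 r) -> computable 0 F (pc n (hi r)).
  apply: comp_copy => i lti; left; exists (i + n)%N => [|x]; first by lia.
  by rewrite coef_drop_poly.
have szlo r x : (size (lo r x) <= n)%N by apply: size_take_poly.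
have szhi r : (forall x, size (r x) <= n.*2)%N -> forall x, (size (hi r x) <= n)%N.
  by move=> sz x; rewrite size_drop_poly; have := sz x; lia.
have Hp := comp_catl (pc n.*2 p) (pc n.*2 q).
have Hq := comp_catr (pc n.*2 p) (pc n.*2 q).
pose N := (n.*2.*2).-1.
have mul r s : computable 0 F (pc n r) -> computable 0 F (pc n s) ->
    (forall x, size (r x) <= n)%N -> (forall x, size (s x) <= n)%N ->
    computable b F (pc N (fun x => r x * s x)).
  move=> Hr Hs szr szs; apply: (@comp_resize _ _ (n.*2).-1) => [x|].
    by apply: leq_trans (size_polyMleq _ _) _; have := szr x; have := szs x; lia.
  exact: comp_trans (comp_cat Hr Hs) (Hm _ _ szr szs).
have P00 := mul _ _ (Hlo _ Hp) (Hlo _ Hq) (szlo p) (szlo q).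
have P01 := mul _ _ (Hlo _ Hp) (Hhi _ Hq) (szlo p) (szhi q szq).
have P10 := mul _ _ (Hhi _ Hp) (Hlo _ Hq) (szhi p szp) (szlo q).
have P11 := mul _ _ (Hhi _ Hp) (Hhi _ Hq) (szhi p szp) (szhi q szq).
have := comp_add P00 (comp_add (comp_shift n (comp_add P01 P10)) (comp_shift n.*2 P11)).
move/(@comp_le _ _ _ (4 * b + 12 * n)) => /(_ _)/comp_pc_ext; apply;
  last by rewrite /N; lia.
move=> x i _; apply: (congr1 (fun r : {poly K} => r`_i)).
rewrite -(poly_take_drop n (p x)) -(poly_take_drop n (q x)) -/(lo p x) -/(hi p x).
by rewrite -/(lo q x) -/(hi q x) -addnn exprD; ring.
Qed.

End PolynomialArithmetic.

(** * The Newton step for E(f) = 0: quadratic convergence and uniqueness of the root *)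

Section NewtonIteration.
Local Open Scope ring_scope.
Variable K : fieldType.
Implicit Types (p q f g H : {poly K}) (A B : K).

Definition theta p := 'X * p^`().

Lemma thetaD p q : theta (p + q) = theta p + theta q.
Proof. by rewrite /theta derivD mulrDr. Qed.

Lemma thetaN p : theta (- p) = - theta p.
Proof. by rewrite /theta derivN mulrN. Qed.

Lemma thetaM p q : theta (p * q) = theta p * q + p * theta q.
Proof. rewrite /theta derivM; ring. Qed.

Lemma thetaZ a p : theta (a *: p) = a *: theta p.
Proof. by rewrite /theta derivZ scalerAr. Qed.

Lemma thetaXn n : theta 'X^n = n%:R * 'X^n.
Proof.
rewrite /theta derivXn; case: n => [|n]; rewrite ?mulr0n ?mul0r ?mulr0 //=.
rewrite exprS -mulr_natl; ring.
Qed.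

Lemma coef_theta p i : (theta p)`_i = i%:R * p`_i.
Proof.
by rewrite /theta coefXM; case: i => [|i]; rewrite ?mul0r //= coef_deriv mulr_natl.
Qed.

Definition hfun f := theta f - f.

Definition weier A B f := hfun f ^+ 2 - f ^+ 3 - A *: ('X^2 * f) - B *: 'X^3.

(** The exact Taylor expansion at [f]: value, part linear in [d], then the quadratic and cubic
    remainder. *)
Lemma weier_add A B f d : weier A B (f + d) =
  weier A B f + (hfun f *+ 2 * hfun d - (3%:R * f ^+ 2 + A *: 'X^2) * d)
  + (hfun d ^+ 2 - 3%:R * f * d ^+ 2 - d ^+ 3).
Proof. rewrite /weier /hfun thetaD -!mul_polyC; ring. Qed.

(* [h = theta f - f] is, up to a power of x, the derivative of wp, so it solves
   the homogeneous linearized equation, and variation of constants reduces the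
   Newton step to a quadrature. *)
Lemma weier_newton A B f H J :
  2%:R * theta J + J = weier A B f * H ->
  weier A B (f - hfun f * J) =
  weier A B f * (1 - hfun f ^+ 2 * H)
  + J * (3%:R * weier A B f - theta (weier A B f))
  + (hfun (hfun f * J) ^+ 2 - 3%:R * f * (hfun f * J) ^+ 2 + (hfun f * J) ^+ 3).
Proof.
move=> EJ; rewrite weier_add.
(* Write E for [weier A B f], h for [hfun f] and L for the linear part of the expansion.
   Substituting [theta f = h + f] shows that [theta E = L(h) + 3 E - h^2]. Hence [L(h J) = h^2 (2
   theta J + J) + J (theta E - 3 E)], whose first term is what the equation for [J] controls. *)
have Ee : theta (weier A B f) = hfun f *+ 2 * theta (hfun f)
   - hfun f * (3%:R * f ^+ 2 + A *: 'X^2) + 3%:R * weier A B f - 3%:R * hfun f ^+ 2.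
  have t2 p : theta (p ^+ 2) = 2%:R * p * theta p by rewrite expr2 thetaM; ring.
  have t3 p : theta (p ^+ 3) = 3%:R * p ^+ 2 * theta p by rewrite exprS thetaM t2; ring.
  rewrite {1}/weier !(thetaD, thetaN, thetaZ, thetaXn, t2, t3, thetaM).
  have -> : theta f = hfun f + f by rewrite /hfun; ring.
  rewrite /weier -!mul_polyC; ring.
rewrite Ee.
have -> : hfun (- (hfun f * J)) = hfun f * J - theta (hfun f) * J - hfun f * theta J.
  rewrite {1}/hfun thetaN thetaM; ring.
have -> : hfun (hfun f * J) = theta (hfun f) * J + hfun f * theta J - hfun f * J.
  rewrite {1}/hfun thetaM; ring.
have -> : weier A B f * (1 - hfun f ^+ 2 * H)
  = weier A B f - hfun f ^+ 2 * (2%:R * theta J + J) by rewrite EJ; ring.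
ring.
Qed.

(** With x = z^2 this is termwise integration in z divided by z: the integral of z^(2i) is z^(2i+1)
    / (2i+1). *)
Definition quadrature p := \poly_(i < size p) (p`_i / (i.*2.+1)%:R).

Hypothesis charK0 : [pchar K] =i pred0.

Lemma natS_neq0 n : n.+1%:R != 0 :> K.
Proof. by rewrite (GRing.pcharf0P K).1. Qed.

Lemma coef_quadrature p i : (quadrature p)`_i = p`_i / (i.*2.+1)%:R.
Proof. by rewrite coef_poly; case: ltnP => // le; rewrite nth_default // mul0r. Qed.

Lemma quadratureP p : 2%:R * theta (quadrature p) + quadrature p = p.
Proof.
apply/polyP => i; rewrite coefD -[2%:R]polyC_natr mul_polyC coefZ coef_theta.
rewrite coef_quadrature.
have := natS_neq0 i.*2; set d := (_.+1)%:R => d0.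
have Ed : d = 2%:R * i%:R + 1 by rewrite /d -addn1 natrD -mul2n natrM.
have := divfK d0 p`_i; move: (p`_i / d) => z <-; rewrite Ed; ring.
Qed.

Lemma dvdXP k p : reflect (forall i, (i < k)%N -> p`_i = 0) ('X^k %| p).
Proof.
apply: (iffP idP) => [/dvdpP[q ->] i lti|E]; first by rewrite coefMXn lti.
rewrite -(poly_take_drop k p) dvdp_add ?dvdp_mull //.
suff -> : take_poly k p = 0 by [].
by apply/polyP => i; rewrite coef_take_poly coef0; case: ltnP => // /E.
Qed.

Lemma dvdX_theta k p : 'X^k %| p -> 'X^k %| theta p.
Proof. by move=> /dvdXP E; apply/dvdXP => i /E Ei; rewrite coef_theta Ei mulr0. Qed.

Lemma dvdX_quadrature k p : 'X^k %| p -> 'X^k %| quadrature p.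
Proof. by move=> /dvdXP E; apply/dvdXP => i /E Ei; rewrite coef_quadrature Ei mul0r. Qed.

Lemma dvdX_hfun k p : 'X^k %| p -> 'X^k %| hfun p.
Proof. by move=> H; rewrite dvdp_sub ?dvdX_theta. Qed.

Lemma dvdX_mul2 k p q : 'X^k %| p -> 'X^k %| q -> 'X^(k.*2) %| p * q.
Proof. by rewrite -addnn exprD; apply: dvdp_mul. Qed.

Lemma hfunD p q : hfun (p + q) = hfun p + hfun q.
Proof. rewrite /hfun thetaD; ring. Qed.

Lemma weier_dvd_add k A B f d :
  'X^k %| d -> ('X^k %| weier A B (f + d)) = ('X^k %| weier A B f).
Proof.
move=> Hd; rewrite weier_add -addrA dvdp_addl //.
have H2 p : 'X^k %| p -> 'X^k %| p ^+ 2 by move=> Hp; rewrite expr2 dvdp_mulr.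
have Hh := dvdX_hfun Hd.
by rewrite dvdp_add ?dvdp_sub ?dvdp_mull ?H2 ?[d ^+ 3]exprS ?dvdp_mull ?H2.
Qed.

Lemma dvdX_take k p : 'X^k %| take_poly k p - p.
Proof.
rewrite -{2}(poly_take_drop k p) opprD addNKr.
by rewrite dvdpNr dvdp_mull.
Qed.

Definition newton_f A B k f H :=
  take_poly k.*2 (f - hfun f * quadrature (weier A B f * H)).

Definition newton_H k f H := take_poly k.*2 (H * (2%:R - hfun f ^+ 2 * H)).

Definition approx A B k f H :=
  [/\ 'X^k %| weier A B f, 'X^k %| 1 - hfun f ^+ 2 * H, f`_0 = 1,
      (size f <= k)%N & (size H <= k)%N].

Lemma approx1 A B : approx A B 1 1 1.
Proof.
have h1 : hfun 1 = -1 :> {poly K} by rewrite /hfun /theta derivC; ring.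
split; rewrite ?size_poly1 ?coef1 //.
- have -> : weier A B 1 = 'X * (- (A *: 'X) - B *: 'X^2).
    rewrite /weier h1 -!mul_polyC; ring.
  by rewrite expr1 dvdp_mulr.
- by rewrite h1 mulr1 expr2 mulrNN mulr1 subrr dvdp0.
Qed.

(** Since [X^k] divides E(f), it divides [J]; every term in [weier_newton] then contains two factors
    divisible by [X^k], which doubles the precision. *)
Lemma approx_newton A B k f H (f' := newton_f A B k f H) : (0 < k)%N ->
  approx A B k f H -> approx A B k.*2 f' (newton_H k f' H).
Proof.
move=> k0 [He Hh f0 szf szH].
set J := quadrature (weier A B f * H).
have HJ : 'X^k %| J by apply/dvdX_quadrature/dvdp_mulr.
have Hd : 'X^k %| hfun f * J by apply: dvdp_mull.
have Ef : 'X^(k.*2) %| f' - (f - hfun f * J) by apply: dvdX_take.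
have Xk2 : 'X^k %| ('X^(k.*2) : {poly K}) by rewrite dvdp_exp2l // -addnn leq_addr.
have Ef' : 'X^k %| f' - f.
  have -> : f' - f = (f' - (f - hfun f * J)) - hfun f * J by ring.
  by rewrite dvdp_sub // (dvdp_trans Xk2).
split; rewrite ?size_take_poly //.
- have -> : f' = f - hfun f * J + (f' - (f - hfun f * J)) by ring.
  rewrite weier_dvd_add // (weier_newton (quadratureP _)).
  have sq p : 'X^k %| p -> 'X^(k.*2) %| p ^+ 2 by move=> Hp; rewrite expr2 dvdX_mul2.
  apply: dvdp_add.
    apply: dvdp_add; apply: dvdX_mul2 => //.
    by apply: dvdp_sub; [apply: dvdp_mull|apply: dvdX_theta].
  apply: dvdp_add; last by rewrite exprS dvdp_mull ?sq.
  apply: dvdp_sub; first by rewrite sq ?dvdX_hfun.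
  by rewrite dvdp_mull ?sq.
- set h := hfun f'.
  (* The old [H] still inverts the square of the new h to precision [k], because [f'] and [f] agree
     modulo [X^k]. The Newton step for the inverse then squares this error. *)
  have Eh : 'X^k %| 1 - h ^+ 2 * H.
    have Dh : h = hfun f + hfun (f' - f) by rewrite -hfunD addrC subrK.
    have -> : 1 - h ^+ 2 * H = 1 - hfun f ^+ 2 * H
       - hfun (f' - f) * ((h + hfun f) * H) by rewrite Dh; ring.
    by rewrite dvdp_sub // dvdp_mulr // dvdX_hfun.
  have -> : 1 - h ^+ 2 * newton_H k f' H = (1 - h ^+ 2 * H) ^+ 2
    - h ^+ 2 * (newton_H k f' H - H * (2%:R - h ^+ 2 * H)) by ring.
  by apply: dvdp_sub; [rewrite expr2 dvdX_mul2 | apply: dvdp_mull; apply: dvdX_take].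
- have /dvdXP/(_ 0%N k0) := Ef'; rewrite coefB f0 => /eqP; rewrite subr_eq0 => /eqP //.
Qed.

(** By induction on the order of agreement: if [g - f = w X^m] with [m > 0], the coefficient of
    [X^m] in E(g) - E(f) is [-(2m+1) w(0)], so characteristic zero forces [w(0) = 0]. *)
Lemma weier_inj k A B f g : 'X^k %| weier A B f -> 'X^k %| weier A B g ->
  f`_0 = 1 -> g`_0 = 1 -> forall i, (i < k)%N -> f`_i = g`_i.
Proof.
move=> Hf Hg f0 g0.
suff H m : (m <= k)%N -> 'X^m %| g - f.
  move=> i lti; have /dvdXP/(_ i lti)/eqP := H k (leqnn k).
  by rewrite coefB subr_eq0 => /eqP.
elim: m => [|m IH] ltm; first by rewrite expr0 dvd1p.
have /dvdpP[w Ew] := IH (ltnW ltm).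
case: (posnP m) => [m0|m0].
  by rewrite m0; apply/dvdXP => -[|i] //; rewrite coefB f0 g0 subrr.
have hd : hfun (g - f) = ((m%:R - 1) *: w + theta w) * 'X^m.
  by rewrite Ew /hfun thetaM thetaXn -mul_polyC polyCB polyC_natr; ring.
have : 'X^(m.+1) %| weier A B g - weier A B f.
  by rewrite dvdp_sub // (dvdp_trans _ Hf, dvdp_trans _ Hg) // dvdp_exp2l.
have {1}-> : g = f + (g - f) by ring.
rewrite weier_add hd Ew.
set a := (m%:R - 1) *: w + theta w.
have -> : weier A B f +
     (hfun f *+ 2 * (a * 'X^m) - (3%:R * f ^+ 2 + A *: 'X^2) * (w * 'X^m))
   + ((a * 'X^m) ^+ 2 - 3%:R * f * (w * 'X^m) ^+ 2 - (w * 'X^m) ^+ 3) - weier A B f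
  = (hfun f *+ 2 * a - (3%:R * f ^+ 2 + A *: 'X^2) * w
     + 'X^m * (a ^+ 2 - 3%:R * f * w ^+ 2 - w ^+ 3 * 'X^m)) * 'X^m by ring.
(* After removing the factor [X^m], the nonlinear terms still carry another [X^m] with [m > 0], so
   only the linear part contributes to the constant term. *)
move/dvdXP/(_ m (ltnSn m)); rewrite coefMXn ltnn subnn.
have h0 : (hfun f)`_0 = -1 by rewrite /hfun coefB coef_theta f0; ring.
have a0 : a`_0 = (m%:R - 1) * w`_0 by rewrite coefD coefZ coef_theta; ring.
rewrite coefD coefXnM m0 addr0 coefB !coef0M coefMn h0 a0 coefD coefZ coefXn /=.
rewrite mulr0 addr0 expr2 !coef0M -polyC_natr coefC f0 !mulr1 /=.
move=> E.
have w0 : w`_0 = 0.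
  have : (m.*2.+1)%:R * w`_0 = 0.
    have -> : m.*2.+1%:R = 2%:R * m%:R + 1 :> K by rewrite -addn1 natrD -mul2n natrM.
    apply: oppr_inj; rewrite oppr0 -[RHS]E; ring.
  by move/eqP; rewrite mulf_eq0 (negPf (natS_neq0 _)) => /eqP.
apply/dvdXP => i; rewrite ltnS coefMXn leq_eqVlt => /orP[/eqP ->|->] //.
by rewrite ltnn subnn.
Qed.

End NewtonIteration.

(** * From the Laurent differential equation to the polynomial equation modulo [X^n] *)

Section LaurentPrefixes.
Local Open Scope ring_scope.
Variable K : fieldType.
Implicit Types (u v : int -> K) (P Q : {poly K}).

(* [u = z^-a P] up to a multiple of [z^(N-a)]. *)
Definition lprefix (a N : nat) u P : Prop :=
  (forall k : int, k < - a%:Z -> u k = 0) /\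
  (forall i : nat, (i < N)%N -> u (i%:Z - a%:Z) = P`_i).

(** The pole bounds make one factor vanish outside [m + 1] indices, turning the finitely supported
    sum into an ordinary convolution. *)
Lemma lmul_shift a b u v m :
  (forall k : int, k < - a%:Z -> u k = 0) ->
  (forall k : int, k < - b%:Z -> v k = 0) ->
  lmul u v (m%:Z - (a + b)%:Z) =
  \sum_(i < m.+1) u (i%:Z - a%:Z) * v ((m - i)%:Z - b%:Z).
Proof.
move=> Hu Hv; rewrite /lmul.
pose r := [seq i%:Z - a%:Z | i <- iota 0 m.+1].
rewrite (fsbigE r) //.
- rewrite (eq_bigl xpredT) => [|i]; last by rewrite in_setT.
  rewrite big_map -/(index_iota 0 m.+1) big_mkord; apply: eq_bigr => i _.
  have := ltn_ord i; rewrite ltnS => lei.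
  by congr (_ * v _); rewrite -subzn // PoszD; ring.
- by rewrite map_inj_uniq ?iota_uniq // => i j /addIr [].
- move=> k _ kr; case: (ltP k (- a%:Z)) => [/Hu ->|le1]; first by rewrite mul0r.
  rewrite Hv ?mulr0 //; apply: contraNT kr; rewrite -leNgt => le2.
  by apply/mapP; exists (absz (k + a%:Z)); rewrite ?mem_iota; lia.
Qed.

Lemma lprefix_mul a b N u v P Q : lprefix a N u P -> lprefix b N v Q ->
  lprefix (a + b) N (lmul u v) (P * Q).
Proof.
move=> [u0 uP] [v0 vQ]; split=> [k ltk|i lti].
  rewrite /lmul (fsbig1) // => i _.
  case: (ltP i (- a%:Z)) => [/u0 ->|le1]; first by rewrite mul0r.
  by rewrite v0 ?mulr0 //; lia.
rewrite lmul_shift // coefM; apply: eq_bigr => j _.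
have := ltn_ord j; rewrite ltnS => lej.
by rewrite uP ?vQ //; lia.
Qed.

(** The derivative of z^-a P is z^(-a-1) (z P' - a P): the pole order rises by one and the number of
    known coefficients is unchanged. *)
Lemma lprefix_deriv a N u P : lprefix a N u P ->
  lprefix a.+1 N (lderiv u) (theta P - a%:R *: P).
Proof.
move=> [u0 uP]; split=> [k ltk|i lti]; rewrite /lderiv.
  by rewrite u0 ?mulr0 //; lia.
have -> : i%:Z - a.+1%:Z + 1 = i%:Z - a%:Z by lia.
rewrite uP // coefB coef_theta coefZ -mulrBl; congr (_ * _).
by rewrite intrB.
Qed.

(** The truncation of z^2 wp as a polynomial in x = z^2; the coefficient of x is 0 because wp has no
    constant term. *)
Definition wp_poly (c : nat -> K) n : {poly K} :=
  \poly_(i < n) (if i == 0%N then 1 else if i == 1%N then 0 else c i.-1).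

Lemma lprefix_wp c n : lprefix 2 n.*2 (wp_series c) (wp_poly c n \Po 'X^2).
Proof.
split=> [[k|[|[|k]]]|i lti] //=; rewrite coef_comp_poly_Xn // coef_poly.
case: i lti => [|[|i]] lti; first by case: n lti.
  by [].
have -> : i.+2%:Z - 2%:Z = i%:Z by lia.
rewrite /= dvdn2 /= negbK; case: (boolP (odd i)) => oi; first by rewrite andbF.
have -> : (i.+2 %/ 2 = i./2.+1)%N by rewrite divn2.
rewrite andbT /=; case: i lti oi => [|[|i]] //= lti oi; first by case: ifP.
by rewrite ifT //; lia.
Qed.

Lemma theta_comp_X2 P : theta (P \Po 'X^2) = 2%:R *: (theta P \Po 'X^2).
Proof.
rewrite /theta deriv_comp derivXn /= comp_polyM comp_polyX -mul_polyC polyC_natr.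
by rewrite -mulr_natl expr1 expr2; ring.
Qed.

Hypothesis charK0 : [pchar K] =i pred0.

Lemma wp_poly_weier A B c n : is_wp A B c -> 'X^n %| weier A B (wp_poly c n).
Proof.
move=> Hc; set g := wp_poly c n; pose P := g \Po 'X^2.
have HP : lprefix 2 n.*2 (wp_series c) P by apply: lprefix_wp.
have HL := lprefix_mul (lprefix_deriv HP) (lprefix_deriv HP).
have HR := lprefix_mul HP (lprefix_mul HP HP).
(* [W] is the differential equation multiplied by z^6, the common pole order of wp'^2 and wp^3. By
   the chain rule [theta] doubles under x = z^2, so [W] becomes 4 E(g) evaluated at z^2. *)
pose W := (theta P - 2%:R *: P) ^+ 2 - 4%:R *: (P ^+ 3 + A *: ('X^4 * P) + B *: 'X^6).
have HW i : (i < n.*2)%N -> W`_i = 0.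
  move=> lti; have := Hc (i%:Z - 6%:Z); rewrite -/(3 + 3)%N.
  rewrite (HL.2 i lti) -/(2 + (2 + 2))%N (HR.2 i lti) => E.
  rewrite coefB expr2 E coefZ; apply/eqP; rewrite subr_eq0; apply/eqP.
  congr (_ * _); rewrite !coefD !coefZ coefXnM coefXn !exprS expr0 mulr1.
  congr (_ + _ + _).
    congr (_ * _); case: ltnP => lei; first by rewrite HP.1 //; lia.
    rewrite -HP.2; last by lia.
    by congr (wp_series c _); lia.
  rewrite /lconst; have -> : (i%:Z - (2 + (2 + 2))%:Z == 0) = (i == 6%N) by lia.
  by case: eqP; rewrite ?mulr1 ?mulr0.
have EW : W = 4%:R *: (weier A B g \Po 'X^2).
  rewrite /W /P theta_comp_X2 /weier /hfun.
  rewrite !(comp_polyB, comp_polyD, comp_polyZ, comp_polyM, exprS, expr0, mulr1).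
  rewrite !comp_polyX.
  rewrite -!mul_polyC !polyC_natr; ring.
apply/dvdXP => i lti; have := HW i.*2; rewrite ltn_double => /(_ lti)/eqP.
rewrite EW coefZ coef_comp_poly_Xn // dvdn2 odd_double /= divn2 doubleK.
by rewrite mulf_eq0 (negPf (natS_neq0 charK0 3)) => /eqP.
Qed.

End LaurentPrefixes.

(** * The cost of one Newton step *)

Section NewtonCost.
Local Open Scope ring_scope.
Variables (K : fieldType) (T : Type).
Implicit Types (F : seq (T -> K)) (p q f H : T -> {poly K}).

Section Unit.
Variables (n b : nat) (F : seq (T -> K)).
Hypothesis Hm : multiplier K T n b.

(** The unit [n + b] pays for one linear pass and one product, so that bounds reduce to counting
    operations on polynomials. *)
Definition cost i p := computable (i * (n + b)) F (pc n p).

Lemma cost_sub i j p q : cost i p -> cost j q -> cost (i + j).+1 (fun x => p x - q x).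
Proof. by move=> Hp Hq; apply: comp_le (comp_sub Hp Hq); lia. Qed.

Lemma cost_mul i j p q : cost i p -> cost j q -> cost (i + j).+1 (fun x => p x * q x).
Proof. by move=> Hp Hq; apply: comp_le (comp_mul Hm Hp Hq); lia. Qed.

Lemma cost_scale i (a : T -> K) p :
  computable 0 F [:: a] -> cost i p -> cost i.+1 (fun x => a x *: p x).
Proof. by move=> Ha Hp; apply: comp_le (comp_scale Ha Hp); lia. Qed.

Lemma cost_diag i (a : nat -> K) p q :
  (forall x j, (j < n)%N -> (q x)`_j = a j * (p x)`_j) -> cost i p -> cost i.+1 q.
Proof. by move=> E Hp; apply: comp_le (comp_diag E Hp); lia. Qed.

Lemma cost_const (c : {poly K}) : cost 0 (fun=> c).
Proof.
apply: (@comp_copy _ _ _ _ 0 _ (fun=> 0)) => [i _|]; last exact: comp_nil.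
by right; exists c`_i.
Qed.

Lemma cost_hfun i f : cost i f -> cost (i + i).+2 (fun x => hfun (f x)).
Proof.
move=> Hf; rewrite -addSn; apply: cost_sub => //.
by apply: (cost_diag (a := fun j => j%:R)) Hf => x j _; rewrite coef_theta.
Qed.

Variables A B : T -> K.
Hypotheses (FA : computable 0 F [:: A]) (FB : computable 0 F [:: B]).

Lemma cost_weier f : cost 0 f -> cost 12 (fun x => weier (A x) (B x) (f x)).
Proof.
move=> Hf; have Hh := cost_hfun Hf.
have Hf3 := cost_mul Hf (cost_mul Hf Hf).
have HAf := cost_scale FA (comp_shift 2 Hf : cost 0 _).
have HB := cost_scale FB (cost_const 'X^3).
exact: (cost_sub (cost_sub (cost_sub (cost_mul Hh Hh) Hf3) HAf) HB).
Qed.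

End Unit.

Variables A B : T -> K.

Definition state k f H := [:: A; B] ++ pc k f ++ pc k H.

Lemma comp_newton k b f H
    (f' := fun x => newton_f (A x) (B x) k (f x) (H x)) :
  multiplier K T k.*2 b ->
  (forall x, (size (f x) <= k)%N) -> (forall x, (size (H x) <= k)%N) ->
  computable (26 * (k.*2 + b)) (state k f H)
    (state k.*2 f' (fun x => newton_H k (f' x) (H x))).
Proof.
move=> Hm szf szH; set n := k.*2; set F := state k f H.
have FA : computable 0 F [:: A] := comp_nth (isT : 0 < size F)%N.
have FB : computable 0 F [:: B] := comp_nth (isT : 1 < size F)%N.
have Ff : cost n b F 0 f.
  apply: comp_resize szf _; apply: comp_catrr; exact: comp_catl.
have FH : cost n b F 0 H.
  apply: comp_resize szH _; apply: comp_catrr; exact: comp_catr.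
have take c G r : cost n b G c r -> cost n b G c (fun x => take_poly n (r x)).
  by apply: comp_pc_ext => x i lti; rewrite coef_take_poly lti.
have Ff' : cost n b F 18 f'.
  apply: take; apply: (cost_sub (i := 0) (j := 17)) => //.
  apply: (cost_mul Hm (i := 2) (j := 14)); first exact: cost_hfun Ff.
  apply: (cost_diag (a := fun i => (i.*2.+1)%:R^-1)
           (p := fun x => weier (A x) (B x) (f x) * H x)).
    by move=> x i _; rewrite coef_quadrature mulrC.
  exact: (cost_mul Hm (cost_weier Hm FA FB Ff) FH).
(* 18 units produce [f'] (12 of them for E(f)) and 8 update [H]; [f'] is kept in memory between the
   two. *)
rewrite (_ : 26 * (n + b) = 18 * (n + b) + 8 * (n + b))%N; last by lia.
apply: comp_let Ff' _.
have Gf' : cost n b (F ++ pc n f') 0 f' by apply: comp_catr.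
have GH : cost n b (F ++ pc n f') 0 H by apply: comp_catll.
have Gh := cost_hfun Gf'.
have G2 : cost n b (F ++ pc n f') 0 (fun=> 2%:R) by apply: cost_const.
have GH2 := cost_sub G2 (cost_mul Hm (cost_mul Hm Gh Gh) GH).
have GH' := take _ _ _ (cost_mul Hm GH GH2).
rewrite -(add0n (8 * _)%N); apply: comp_cat; last exact: (comp_cat (b1 := 0) Gf' GH').
apply: comp_catll; exact: (comp_cat (b1 := 0) (b2 := 0) FA FB).
Qed.

Fixpoint newton j x : {poly K} * {poly K} :=
  if j is j'.+1 then
    let: (f, H) := newton j' x in
    let f' := newton_f (A x) (B x) (2 ^ j') f H in (f', newton_H (2 ^ j') f' H)
  else (1, 1).

Definition newton_state j :=
  state (2 ^ j) (fun x => (newton j x).1) (fun x => (newton j x).2).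

Lemma newton_approx j x : [pchar K] =i pred0 ->
  approx (A x) (B x) (2 ^ j) (newton j x).1 (newton j x).2.
Proof.
move=> charK0; elim: j => [|j] /=; first exact: approx1.
case: (newton j x) => f H /=; rewrite expnS mul2n.
by apply: approx_newton => //; rewrite expn_gt0.
Qed.

Lemma comp_newton_step j b : [pchar K] =i pred0 ->
  multiplier K T (2 ^ j.+1) b ->
  computable (26 * (2 ^ j.+1 + b)) (newton_state j) (newton_state j.+1).
Proof.
move=> charK0; rewrite /newton_state expnS mul2n => Hm.
have sz x := newton_approx j x charK0.
apply: comp_ext (comp_newton Hm _ _) => x; last 2 first.
- by case: (sz x).
- by case: (sz x).
rewrite /evs /state !map_cat -!/(evs _ _) !evs_pc /=.
by case: (newton j x).
Qed.

Lemma comp_newton0 : computable 0 [:: A; B] (newton_state 0).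
Proof.
apply: (comp_cat (b1 := 0) (b2 := 0)); first exact: comp_id.
by apply: (comp_cat (b1 := 0) (b2 := 0)); apply: (cost_const 1 0).
Qed.

End NewtonCost.

(** * Consequences of superlinearity and the geometric sum of the costs *)

Section MultiplicationTime.
Variables (K : fieldType) (M : nat -> nat).
Hypothesis charK0 : ([pchar K] =i pred0)%R.
Hypothesis mulM : multiplication_time K M.
Hypothesis supM : superlinear M.

Fixpoint ctree_consts (t : ctree K) : seq K :=
  match t with
  | Output _ => [::]
  | Const a t' => a :: ctree_consts t'
  | Arith _ _ _ t' => ctree_consts t'
  | IfZero _ t0 t1 => ctree_consts t0 ++ ctree_consts t1
  end.

Lemma read_sub (s : seq K) idx out : read s idx = Some out -> {subset out <= s}.
Proof.
elim: idx out => [|i idx IH] out /=; first by move=> [<-].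
case E: (onth s i) => [x|] //; case R: (read s idx) => [xs|] //= [<-] y.
rewrite inE => /orP[/eqP->|]; last exact: IH.
elim: s i E {IH R} => [|z s IH] [|i] //=; first by move=> [->]; rewrite mem_head.
by move/IH; rewrite inE orbC => ->.
Qed.

Lemma run_free_sub t s out :
  run t s = Some (0, out) -> {subset out <= s ++ ctree_consts t}.
Proof.
elim: t s => [idx|a t IH|o i j t IH|i t0 IH0 t1 IH1] s /=.
- by case E: (read s idx) => [xs|] //= [<-]; rewrite cats0; apply: read_sub E.
- by move=> /IH; rewrite cat_rcons.
- case: (onth s i) => [x|] //; case: (onth s j) => [y|] //.
  by case: (arith o x y) => [z|] //; case: (run _ _).
- case: (onth s i) => [x|] //.
  case: ifP => _ => [/IH0|/IH1] sub y /sub; rewrite !mem_cat => /orP[->|->] //;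
    by rewrite ?orbT.
Qed.

Lemma natr_inj_char0 : injective (fun m => m%:R%R : K).
Proof.
have half m n : (m%:R = n%:R :> K)%R -> m <= n.
  move=> E; rewrite leqNgt; apply/negP => lt.
  have := (pcharf0P K).1 charK0 (m - n); rewrite natrB ?E ?subrr ?eqxx; last exact: ltnW.
  by move/esym; rewrite subn_eq0 leqNgt lt.
by move=> m n E; apply/eqP; rewrite eqn_leq !half.
Qed.

(* A tree that performs no operation outputs inputs and constants, but the
   squares of the integers are infinitely many. *)
Lemma time1_gt0 : 0 < M 1.
Proof.
rewrite lt0n; apply/eqP => M10; have [t Ht] := mulM 1.
(* Starting from 2 excludes 0 and 1, whose squares could be copied from the input. *)
pose c := ctree_consts t; pose f i : K := ((i.+2 ^ 2)%:R)%R.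
have inj : injective f.
  by move=> i j /natr_inj_char0/eqP; rewrite eqn_exp2r // => /eqP[].
suff sub : {subset [seq f i | i <- iota 0 (size c).+1] <= c}.
  have := uniq_leq_size _ sub; rewrite map_inj_uniq // iota_uniq => /(_ isT).
  by rewrite size_map size_iota ltnn.
move=> _ /mapP[i _ ->].
have sz : size ((i.+2%:R)%:P : {poly K})%R <= 1 by apply: size_polyC_leq1.
have [k + lek] := Ht _ _ sz sz.
have -> : k = 0 by apply/eqP; rewrite -leqn0 -M10.
have coefs1 (a : K) : coefs 1 (a%:P)%R = [:: a] by rewrite /coefs /mkseq /= coefC.
rewrite -polyCM -natrM !coefs1 => /run_free_sub/(_ (f i)).
by rewrite !inE eqxx => /(_ isT)/or3P[/eqP/natr_inj_char0|/eqP/natr_inj_char0|//]; nia.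
Qed.

Lemma superlinear_nat n n' : 0 < n -> n <= n' -> M n * n' <= M n' * n.
Proof.
move=> n0 le; have := supM n0 le.
rewrite ler_pdivrMr ?ltr0n // mulrAC ler_pdivlMr ?ltr0n ?(leq_trans n0) //.
by rewrite -!natrM ler_nat.
Qed.

(** Superlinearity propagates [M 1 >= 1] to all sizes; linear passes can thus be charged to
    multiplications. *)
Lemma time_ge n : n <= M n.
Proof.
case: n => // n; have := superlinear_nat (isT : 0 < 1) (isT : 1 <= n.+1).
have := time1_gt0; nia.
Qed.

Lemma time_mono n n' : 0 < n -> n <= n' -> M n <= M n'.
Proof. move=> n0 le; have := superlinear_nat n0 le; nia. Qed.

Lemma comp_newton_state (T : Type) (A B : T -> K) j :
  computable (104 * M (2 ^ j)) [:: A; B] (newton_state A B j).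
Proof.
elim: j => [|j IH]; first by apply: comp_le (comp_newton0 A B).
have Hm := @multiplier_time K T M mulM (2 ^ j.+1).
apply: comp_le (comp_trans IH (comp_newton_step _ _ charK0 Hm)).
have j0 : 0 < 2 ^ j by rewrite expn_gt0.
(* The new step costs at most [52 * M (2 ^ j.+1)]. As [2 * M (2 ^ j) <= M (2 ^ j.+1)], the earlier
   steps cost at most as much again, which explains 104. *)
have := superlinear_nat j0 (leq_addr (2 ^ j) _); have := time_ge (2 ^ j.+1).
rewrite expnS mul2n -addnn; nia.
Qed.

End MultiplicationTime.

Theorem theorem1 (K : fieldType) (charK0 : ([pchar K] =i pred0)%R)
    (M : nat -> nat) (mulM : multiplication_time K M) (supM : superlinear M) :
  exists C : nat, forall n : nat, exists t : ctree K,
    forall (A B : K) (c : nat -> K), is_wp A B c ->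
      computes_within t (C * M n)%N [:: A; B] [seq c i | i <- iota 1 n].
Proof.
(* 2964 = 104 + 26 * (2 + 16) + 26 * (4 + 88): all steps up to precision
   m = 2^j <= n, then those to 2m and 4m with multipliers of cost 16 M(m), 88 M(m). *)
exists 2964 => n; case: (posnP n) => [->|n0].
  by exists (Output [::]) => A B c _; exists 0.
(* The parameter is the pair (A, B), so a single tree serves all curves. *)
pose T := (K * K)%type; pose j := trunc_log 2 n; pose m := 2 ^ j.
have /andP[lem ltm] := trunc_log_bounds (isT : 1 < 2) n0.
pose f := fun x : T => (newton fst snd j.+2 x).1.
have Hm := @multiplier_time K T M mulM m.
have H2 := multiplier_double Hm; have H4 := multiplier_double H2.
rewrite -!mul2n -!expnS in H2 H4.
have Hstate := comp_trans (comp_trans (comp_newton_state charK0 mulM supM fst snd j)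
  (comp_newton_step _ _ charK0 H2)) (comp_newton_step _ _ charK0 H4).
(* [c n] is the coefficient of index [n + 1] in f, and [2m] may equal [n + 1]; hence two doublings
   beyond [m]. *)
have ltn4 : n.+1 < 2 ^ j.+2 by move: ltm; rewrite !expnS -/j -/m; lia.
have Hf : computable (2964 * M n) [:: fst; snd]
    (mkseq (fun i (x : T) => (f x)`_i.+2)%R n).
  have m0 : 0 < m by rewrite expn_gt0.
  have leM := time_mono supM m0 lem; have geM := time_ge charK0 mulM supM m.
  have : computable 0 (newton_state fst snd j.+2) (pc (2 ^ j.+2) f).
    by apply: comp_catrr; apply: comp_catl.
  move/(comp_trans Hstate) => Hf.
  have Hc : computable (0 + n * 0) (pc (2 ^ j.+2) f)
      (pc n (fun x => drop_poly 2 (f x)))%R.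
    apply: comp_pcwise (comp_id _) _ => i lti.
    apply: (@comp_scalar_ext _ _ _ _ (fun x => (f x)`_i.+2)%R) => [x|].
      by rewrite coef_drop_poly addn2.
    by apply: comp_coef (comp_id _); lia.
  apply: comp_le (comp_ext _ (comp_trans Hf Hc)) => [|x].
    by rewrite !expnS -/m; lia.
  rewrite evs_pc /evs /mkseq -map_comp; apply: eq_map => i /=.
  by rewrite coef_drop_poly addn2.
have [t Ht] := Hf; exists t => A B c Hc; have := Ht (A, B).
congr computes_within; rewrite /evs /mkseq -map_comp (iotaDl 1 0) -map_comp.
apply/eq_in_map => i; rewrite mem_iota => /andP[_ lti] /=.
(* The Newton iterate and the truncation of z^2 wp both solve E = 0 to precision [2 ^ j.+2] with
   constant term 1, so their coefficients agree. *)
have [Hw _ f0 _ _] := newton_approx fst snd j.+2 (A, B) charK0.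
have Hwp := wp_poly_weier charK0 (2 ^ j.+2) Hc.
have wp0 : ((wp_poly c (2 ^ j.+2))`_0 = 1)%R by rewrite coef_poly expn_gt0.
have lti2 : i.+2 < 2 ^ j.+2 by lia.
by rewrite /f (weier_inj charK0 Hw Hwp f0 wp0 lti2) coef_poly lti2.
Qed.
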